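(* Let $G$ be a simple graph with maximum degree $\Delta(G)$ and let $r \geq 2$ be an integer. Then $\chi_r(G) \leq (r - 1)(\Delta(G) + 1) + 2$.
   Context: Graphs are finite and simple. For a vertex $v$, $N(v)$ is its set of neighbors and $\deg(v)=|N(v)|$; $\Delta(G)$ is the maximum vertex degree. For a coloring $\phi$ and a set of vertices $U$, $\phi(U)=\{\phi(u): u\in U\}$. An $r$-hued coloring of $G$ is a proper vertex coloring $\phi$ of $G$ (adjacent vertices receive distinct colors) such that $|\phi(N(v))| \geq \min\{r, \deg(v)\}$ for every vertex $v$. The $r$-hued chromatic number $\chi_r(G)$ is the minimum number of colors in an $r$-hued coloring of $G$. *)

(* Defs.v *)
From mathcomp Require Import all_boot.

Set Implicit Arguments.
Unset Strict Implicit.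
Unset Printing Implicit Defensive.

Record sgraph := SGraph {
  vertex :> finType;
  adj : rel vertex;
  adj_sym : symmetric adj;
  adj_irrefl : irreflexive adj
}.

Definition neighbors (G : sgraph) (v : G) : {set G} := [set u | adj v u].

Definition degree (G : sgraph) (v : G) : nat := #|neighbors v|.

(* The empty graph gets maximum degree 0. *)
Definition max_degree (G : sgraph) : nat := \max_(v : G) degree v.

Definition proper_coloring (G : sgraph) (C : finType) (phi : {ffun G -> C}) :
  bool := [forall u, forall v, adj u v ==> (phi u != phi v)].

Definition hued_coloring (r : nat) (G : sgraph) (C : finType)
    (phi : {ffun G -> C}) : bool :=
  proper_coloring phi &&
  [forall v : G, minn r (degree v) <= #|phi @: neighbors v|].

(* Not all k colors need be used; this does not affect the minimum over k. *)
Definition hued_colorable (r : nat) (G : sgraph) (k : nat) : bool :=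
  [exists phi : {ffun G -> 'I_k}, hued_coloring r phi].

Lemma hued_colorable_ex (r : nat) (G : sgraph) :
  exists k, hued_colorable r G k.
Proof.
exists #|G|; apply/existsP; exists [ffun v => enum_rank v].
have inj : injective [ffun v : G => enum_rank v].
  by move=> u v; rewrite !ffunE => /enum_rank_inj.
apply/andP; split.
  apply/forallP=> u; apply/forallP=> v; apply/implyP=> uv.
  by rewrite (inj_eq inj); apply: contraTneq uv => ->; rewrite adj_irrefl.
by apply/forallP=> v; rewrite card_imset // geq_minr.
Qed.

Definition hued_chromatic_number (r : nat) (G : sgraph) : nat :=
  ex_minn (hued_colorable_ex r G).

(* Main.v *)
(** For every vertex [w] fix a set [S w] of [minn r (degree w)] neighbors and
    color the graph obtained from [G] by making every [S w] a clique.  If [U]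
    is a set of vertices and [w] has [d] neighbors and [s <= r] elements of
    [S w] in [U], then the clique on [S w] adds at most [(r - 1) s] to the
    degree sum of that graph on [U], and the edges at [w], when [w] lies in
    [U], add [d].  As [d + (r - 1) s <= (r - 1) d + r], and the [d]'s add up
    to at most [max_degree G * #|U|], some vertex of [U] has degree at most
    [(r - 1) * max_degree G + r] inside [U], so greedy coloring succeeds. *)
Require Import Defs.
From mathcomp Require Import all_boot.
From mathcomp Require Import zify.

Set Implicit Arguments.
Unset Strict Implicit.
Unset Printing Implicit Defensive.

(** Greedy argument: set aside a vertex with at most [D] neighbors in [U], color the rest of [U],
    then give that vertex one of the [D.+1] colors that its neighbors in [U] miss. *)
Lemma degenerate_coloring (T : finType) (e : rel T) (D : nat) :
    symmetric e -> irreflexive e ->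
    (forall U : {set T}, U != set0 ->
       exists2 v, v \in U & #|[set u in U | e v u]| <= D) ->
  exists phi : {ffun T -> 'I_D.+1}, forall u v, e u v -> phi u != phi v.
Proof.
move=> e_sym e_irr degen.
(* The induction constrains colors on [U] only; values outside [U] are arbitrary. *)
suff col n (U : {set T}) : #|U| = n -> exists phi : {ffun T -> 'I_D.+1},
    {in U &, forall u v, e u v -> phi u != phi v}.
  have [phi phiP] := col _ [set: T] erefl.
  by exists phi => u v; apply: phiP; rewrite inE.
elim: n U => [|n IHn] U cardU.
  exists [ffun=> ord0] => u v.
  by move/eqP: cardU; rewrite cards_eq0 => /eqP ->; rewrite inE.
have /degen[v vU le_D] : U != set0 by rewrite -cards_eq0 cardU.
have /IHn[phi phiP] : #|U :\ v| = n.
  by move: (cardsD1 v U); rewrite vU cardU; case.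
have [c c_free] : exists c, c \notin phi @: [set u in U | e v u].
  apply/existsP; rewrite -negb_forall; apply/negP => /forallP all_used.
  have := leq_trans (leq_imset_card phi _) le_D.
  rewrite (_ : phi @: _ = [set: 'I_D.+1]) ?cardsT ?card_ord ?ltnn //.
  by apply/setP=> c; rewrite in_setT all_used.
have freeP u : u \in U -> e v u -> phi u != c.
  move=> uU evu; apply: contraNneq c_free => <-.
  by apply: imset_f; rewrite inE uU.
exists [ffun u => if u == v then c else phi u] => x y xU yU exy.
rewrite !ffunE; case: (eqVneq x v) => [xv|xv]; case: (eqVneq y v) => [yv|yv].
- by rewrite xv yv e_irr in exy.
- by rewrite eq_sym freeP // -xv.
- by rewrite freeP // -yv e_sym.
- by apply: phiP; rewrite // !inE ?xv ?yv.
Qed.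

Lemma subset_of_card (T : finType) (A : {set T}) (k : nat) :
  k <= #|A| -> exists2 B : {set T}, B \subset A & #|B| = k.
Proof.
move=> le_k; exists [set x in take k (enum A)].
  by apply/subsetP=> x; rewrite inE => /mem_take; rewrite mem_enum.
rewrite cardsE (card_uniqP _) ?take_uniq ?enum_uniq //.
by rewrite size_takel // -cardE.
Qed.

Lemma exists_small_term (T : finType) (U : {set T}) (f : T -> nat) (m : nat) :
  U != set0 -> \sum_(v in U) f v <= m * #|U| -> exists2 v, v \in U & f v <= m.
Proof.
move=> U0 le_m; apply/exists_inP; apply: contraLR le_m => /exists_inPn big.
rewrite -ltnNge; apply: (@leq_trans (\sum_(v in U) m.+1)).
  by rewrite sum_nat_const [leqRHS]mulnC ltn_pmul2r ?card_gt0.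
by apply: leq_sum => v vU; rewrite ltnNge big.
Qed.

Section Conflict.

Variables (G : sgraph) (S : G -> {set G}) (r : nat).
Hypothesis r_ge2 : 2 <= r.
Hypothesis sub_S : forall w, S w \subset neighbors w.
Hypothesis card_S : forall w, #|S w| <= r.

(** Colorings proper for this relation are proper for [G] and injective on every [S w]. *)
Definition conflict (u v : G) : bool :=
  (u != v) && (adj u v || [exists w, (u \in S w) && (v \in S w)]).

Lemma conflict_sym : symmetric conflict.
Proof.
move=> u v; rewrite /conflict eq_sym adj_sym; congr (_ && (_ || _)).
by apply: eq_existsb => w; rewrite andbC.
Qed.

Lemma conflict_irr : irreflexive conflict.
Proof. by move=> u; rewrite /conflict eqxx. Qed.

(** Each conflict of [v] comes from an edge or from a clique [S w] containing [v]; the predecessor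
    discards [v] itself, which lies in [S w :&: U]. *)
Lemma conflict_degree (U : {set G}) (v : G) :
  v \in U ->
  #|[set u in U | conflict v u]| <=
    #|neighbors v :&: U| + \sum_(w | v \in S w) #|S w :&: U|.-1.
Proof.
move=> vU.
have sub : [set u in U | conflict v u] \subset
    (neighbors v :&: U) :|: \bigcup_(w | v \in S w) ((S w :&: U) :\ v).
  apply/subsetP=> u; rewrite !inE => /and3P[uU vu /orP[-> | /existsP[w]]].
    by rewrite uU.
  case/andP=> vS uS; apply/orP; right; apply/bigcupP; exists w => //.
  by rewrite !inE eq_sym vu uS.
apply: (leq_trans (subset_leq_card sub)); apply: (leq_trans (leq_card_setU _ _)).
rewrite leq_add2l.
elim/big_rec2: _ => [|w m A vS le_A]; first by rewrite cards0.
apply: (leq_trans (leq_card_setU _ _)); rewrite leq_add //.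
by rewrite [in leqRHS](cardsD1 v) inE vS vU.
Qed.

Lemma sum_card_neighbors (U : {set G}) :
  \sum_(w : G) #|neighbors w :&: U| = \sum_(v in U) degree v.
Proof.
rewrite (eq_bigr (fun w => \sum_(v in U | adj w v) 1)); last first.
  by move=> w _; rewrite sum1dep_card; apply: eq_card => v; rewrite !inE andbC.
rewrite (exchange_big_dep (mem U)) /= => [|w v _ /andP[] //].
apply: eq_bigr => v vU; rewrite sum1dep_card; apply: eq_card => w.
by rewrite !inE vU adj_sym.
Qed.

Lemma conflict_degree_sum (U : {set G}) :
  \sum_(v in U) #|[set u in U | conflict v u]| <=
    (r.-1 * max_degree G + r) * #|U|.
Proof.
apply: leq_trans; first by apply: leq_sum => v; apply: conflict_degree.
(* Regroup by [w]: each of the [s] members of [S w :&: U] pays [s.-1], so the clique costs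
   [s * s.-1]. *)
rewrite big_split /= (exchange_big_dep predT) //=.
rewrite big_mkcond -big_split /=.
apply: (@leq_trans
    (\sum_(w : G) (r.-1 * #|neighbors w :&: U| + (if w \in U then r else 0)))).
  apply: leq_sum => w _; rewrite sum_nat_const.
  rewrite (_ : #|(fun v => _ && _)| = #|S w :&: U|); last first.
    by apply: eq_card => v; rewrite inE andbC.
  have le_d := subset_leq_card (setSI U (sub_S w)).
  have le_r : #|S w :&: U| <= r.
    exact: leq_trans (subset_leq_card (subsetIl _ _)) (card_S w).
  move: #|S w :&: U| #|neighbors w :&: U| le_d le_r => s d le_d le_r.
  (* If [w] is in [U], then [s * s.-1 <= (r - 2) * s + s <= (r - 2) * d + r], and adding [d] gives
     the bound; otherwise [s * s.-1 <= r.-1 * d]. *)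
  case: (w \in U); nia.
rewrite big_split /= -big_distrr /= sum_card_neighbors -big_mkcond /=.
rewrite sum_nat_const mulnDl [#|U| * r]mulnC leq_add2r -mulnA leq_mul2l.
rewrite [_ * #|U|]mulnC -sum_nat_const leq_sum ?orbT // => v _.
exact: (leq_bigmax v).
Qed.

End Conflict.

Theorem theorem4 (G : sgraph) (r : nat) (hr : 2 <= r) :
  hued_chromatic_number r G <= (r - 1) * (max_degree G + 1) + 2.
Proof.
have /fin_all_exists2[S sub_S card_S] (w : G) : exists2 A : {set G},
    A \subset neighbors w & #|A| = minn r (degree w).
  exact/subset_of_card/geq_minr.
have S_le w : #|S w| <= r by rewrite card_S geq_minl.
have [U U0|phi phiP] := @degenerate_coloring G (conflict S)
    (r.-1 * max_degree G + r) (conflict_sym S) (conflict_irr S).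
  by apply: exists_small_term => //; apply: conflict_degree_sum.
rewrite /hued_chromatic_number; case: ex_minnP => k _; apply.
(* The number of colors is one more than the degeneracy bound. *)
have -> : (r - 1) * (max_degree G + 1) + 2 = (r.-1 * max_degree G + r).+1.
  nia.
apply/existsP; exists phi; apply/andP; split.
  apply/forallP=> u; apply/forallP=> v; apply/implyP=> uv.
  apply: phiP; rewrite /conflict uv andbT.
  by apply: contraTneq uv => ->; rewrite adj_irrefl.
(* As [S w] is a clique of conflicts, [phi] is injective on it, so the neighbors of [w] already show
   [minn r (degree w)] colors there. *)
apply/forallP=> w; rewrite -card_S.
rewrite -(_ : #|phi @: S w| = #|S w|) ?subset_leq_card ?imsetS //.
apply: card_in_imset => u v uS vS; apply: contra_eq => uv.
apply: phiP; rewrite /conflict uv; apply/orP; right.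
by apply/existsP; exists w; rewrite uS.
Qed.
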